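(* Let $L$ be a finite-dimensional Lie algebra over a field $F$. Then (i) for every $x\in L$, the subalgebra $\langle x, Z^*(L)\rangle$ generated by $x$ and $Z^*(L)$ is nilpotent; (ii) if $F$ has characteristic zero, then $Z^*(L)=\mathrm{nil}(L)$.
   Context: $Z^*(L)$ is the hypercenter of $L$: the union of the upper central series $Z_0(L)=0$, $Z_i(L)/Z_{i-1}(L)=Z(L/Z_{i-1}(L))$. $\langle a,b\rangle$ denotes the Lie subalgebra generated by $a,b$, and $\mathrm{nil}(L)=\{x\in L\mid \langle h,x\rangle \text{ is nilpotent for all } h\in L\}$. *)

(* Defs.v *)
From HB Require Import structures.
From mathcomp Require Import all_boot all_order all_algebra.
Set Implicit Arguments. Unset Strict Implicit. Unset Printing Implicit Defensive.
Import GRing.Theory.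
Local Open Scope ring_scope.

Section Lie.
Variables (F : fieldType) (L : vectType F).

Definition lie_bracket (br : L -> L -> L) : Prop :=
  [/\ (forall (a : F) x y z, br (a *: x + y) z = a *: br x z + br y z),
      (forall (a : F) x y z, br z (a *: x + y) = a *: br z x + br z y),
      (forall x, br x x = 0) &
      (forall x y z, br x (br y z) + br y (br z x) + br z (br x y) = 0)].

Variable br : L -> L -> L.

(* [U, V] : the subspace spanned by all brackets [u, v], u in U, v in V
   (by bilinearity, spanned by brackets of basis vectors). *)
Definition brv (U V : {vspace L}) : {vspace L} :=
  <<[seq br u v | u <- vbasis U, v <- vbasis V]>>%VS.

Definition subalg (K : {vspace L}) : Prop :=
  forall x y, x \in K -> y \in K -> br x y \in K.

Definition generated_subalg (S : L -> Prop) (A : {vspace L}) : Prop :=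
  [/\ subalg A, (forall x, S x -> x \in A) &
      (forall K : {vspace L}, subalg K -> (forall x, S x -> x \in K) ->
         (A <= K)%VS)].

Fixpoint lcs (A : {vspace L}) (n : nat) : {vspace L} :=
  match n with
  | 0%N => A
  | 1%N => A
  | m.+1 => brv A (lcs A m)
  end.

Definition nilpotent (A : {vspace L}) : Prop := exists n, lcs A n = 0%VS.

(* Upper central series: Z_0 = 0 and Z_i / Z_{i-1} = Z(L / Z_{i-1}),
   i.e. Z_i = { x | [x, y] in Z_{i-1} for all y in L }. *)
Fixpoint ucs (i : nat) : L -> Prop :=
  match i with
  | 0%N => fun x => x = 0
  | j.+1 => fun x => forall y, ucs j (br x y)
  end.

Definition hypercenter (x : L) : Prop := exists i, ucs i x.

Definition nilset (x : L) : Prop :=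
  forall h : L, exists A, generated_subalg (fun z => z = h \/ z = x) A
                          /\ nilpotent A.
End Lie.

(* Main.v *)
(** Part (i): the brackets of the subspace F x + Z^* lie in Z^*, and each further
    bracket goes one step down the upper central series.

    Part (ii): an element x of nil(L) is killed by (ad h)^n for every h, where
    n = dim L. In characteristic zero the polynomial t |-> (ad (h + t [h, k]))^n x
    vanishes identically, so its linear coefficient does. That coefficient
    telescopes to (ad h)^n [k, x] - [k, (ad h)^n x] = (ad h)^n [k, x], hence the
    elements killed by all the (ad h)^n form an ideal V. If V were not contained
    in Z^*, Engel's theorem for the action of L on V modulo Z^* would give v in V
    outside Z^* with [L, v] in Z^*, which is absurd. *)
Require Import Defs.
From HB Require Import structures.
From mathcomp Require Import all_boot all_order all_algebra.
From Stdlib Require Import Classical.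
Set Implicit Arguments. Unset Strict Implicit. Unset Printing Implicit Defensive.
Import GRing.Theory.
Local Open Scope ring_scope.

Lemma not_included T (P Q : T -> Prop) :
  ~ (forall x, P x -> Q x) -> exists x, P x /\ ~ Q x.
Proof.
move=> nPQ; apply: NNPP => no; apply: nPQ => x Px.
by apply: NNPP => nQ; apply: no; exists x.
Qed.

(** * Subspaces given by predicates, ascending chains, polynomials with vector coefficients *)

Section LinearAlgebra.
Variables (F : fieldType) (L : vectType F).

Definition subspace (P : L -> Prop) : Prop :=
  P 0 /\ forall (a : F) x y, P x -> P y -> P (a *: x + y).

Lemma subspaceZ P (a : F) x : subspace P -> P x -> P (a *: x).
Proof. by move=> [P0 PL] Px; rewrite -[a *: x]addr0; apply: PL. Qed.

Lemma subspaceD P x y : subspace P -> P x -> P y -> P (x + y).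
Proof. by move=> [P0 PL] Px Py; rewrite -[x]scale1r; apply: PL. Qed.

Lemma subspaceN P x : subspace P -> P x -> P (- x).
Proof. by move=> sP Px; rewrite -scaleN1r; apply: subspaceZ. Qed.

Lemma vspace_subspace (W : {vspace L}) : subspace (fun x => x \in W).
Proof. by split=> [|a x y Wx Wy]; rewrite ?mem0v ?memvD ?memvZ. Qed.

Lemma dim_add_line (W : {vspace L}) w :
  w \notin W -> (\dim W < \dim (W + <[w]>))%N.
Proof.
move=> Ww; rewrite ltn_neqAle (dimv_leqif_sup (addvSl _ _)) dimvS ?addvSl //.
rewrite andbT; apply: contra Ww => /subvP; apply.
exact: (subvP (addvSr _ _)) (memv_line w).
Qed.

Lemma subspace_add_line P (W : {vspace L}) w :
    subspace P -> (forall x, x \in W -> P x) -> P w ->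
  forall x, x \in (W + <[w]>)%VS -> P x.
Proof.
move=> sP WP Pw x /memv_addP[y Wy [_ /vlineP[a ->] ->]].
by apply: subspaceD (WP _ Wy) _ => //; apply: subspaceZ.
Qed.

(** As long as [W] does not exhaust [P], adjoin a line spanned by a missing vector; [n] bounds the
    codimension of [W], which drops each time. *)
Lemma subspace_vspace P :
  subspace P -> exists W : {vspace L}, forall x, x \in W <-> P x.
Proof.
move=> sP.
suff grow n (W : {vspace L}) : (\dim {:L} - \dim W < n)%N ->
    (forall x, x \in W -> P x) ->
    exists W' : {vspace L}, forall x, x \in W' <-> P x.
  apply: (grow _ 0%VS (ltnSn _)) => x; rewrite memv0 => /eqP->.
  by case: sP.
elim: n W => // n IHn W ltW WP.
have [PW|/not_included[w [Pw /negP Ww]]] := classic (forall x, P x -> x \in W).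
  by exists W => x; split=> [/WP|/PW].
apply: (IHn (W + <[w]>)%VS); last exact: subspace_add_line.
rewrite (leq_trans _ (ltW : (_ <= n)%N)) // ltn_sub2l ?dim_add_line //.
by rewrite (leq_trans (dim_add_line Ww)) // dimvS ?subvf.
Qed.

(** Each strict inclusion raises the dimension, so an equality occurs by index dim L, and the last
    hypothesis propagates it forever. Used for the upper central series and for the kernels of the
    powers of [br h]. *)
Lemma subspace_chain_stable (P : nat -> L -> Prop) :
    (forall i, subspace (P i)) -> (forall i x, P i x -> P i.+1 x) ->
    (forall i, (forall x, P i.+1 x -> P i x) ->
       forall x, P i.+2 x -> P i.+1 x) ->
  forall i x, P i x -> P (\dim {:L}) x.
Proof.
move=> sP incP stP.
have mono i j x : (i <= j)%N -> P i x -> P j x.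
  by move=> /subnK <-; elim: (j - i)%N => //= k IHk Px; apply/incP/IHk.
have [j lej stj] : exists2 j, (j <= \dim {:L})%N & forall x, P j.+1 x -> P j x.
  (* Either the chain has already stalled before [i], or [P i] contains a subspace of dimension at
     least [i]. *)
  have alt i : (exists2 j, (j < i)%N & forall x, P j.+1 x -> P j x)
      \/ (exists2 W : {vspace L}, (i <= \dim W)%N & forall x, x \in W -> P i x).
    elim: i => [|i [[j ltji stj]|[W leW WP]]].
    - by right; exists 0%VS => // x; rewrite memv0 => /eqP->; case: (sP 0%N).
    - by left; exists j => //; apply: ltnW.
    have [st|/not_included[w [Pw nPw]]] :=
      classic (forall x, P i.+1 x -> P i x); first by left; exists i.
    right; exists (W + <[w]>)%VS.
      apply: leq_ltn_trans leW (dim_add_line _).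
      by apply/negP => /WP.
    by apply: subspace_add_line => // x /WP/incP.
  case: (alt (\dim {:L}).+1) => [[j ltj stj]|[W ltW _]]; first by exists j.
  by move: (dimvS (subvf W)); rewrite leqNgt ltW.
have stk k : forall x, P (k + j).+1 x -> P (k + j)%N x.
  by elim: k => [|k IHk] //; apply: stP.
move=> i x Pi; apply: (mono j) => //.
have : P (i + j)%N x by apply: (mono i) => //; apply: leq_addr.
by elim: (i) => // k IHk /stk.
Qed.

Lemma natr_inj_pchar0 : [pchar F] =i pred0 -> injective (fun n => n%:R : F).
Proof.
move=> /pcharf0P ch0 m n /eqP.
wlog lemn : m n / (m <= n)%N => [th|].
  by case/orP: (leq_total m n) => [|/th h /eqP e]; [exact: th | rewrite h // e].
by rewrite eq_sym -subr_eq0 -natrB // ch0 subn_eq0 => nm; apply/eqP; rewrite eqn_leq lemn.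
Qed.

(** In each coordinate this is a scalar polynomial vanishing on all of F, which contains infinitely
    many integers in characteristic zero. *)
Lemma vector_poly_eq0 (c : nat -> L) d :
    [pchar F] =i pred0 -> (forall t : F, \sum_(i < d) t ^+ i *: c i = 0) ->
  forall i, (i < d)%N -> c i = 0.
Proof.
move=> ch0 c0 i ltid; rewrite (coord_vbasis (memvf (c i))).
apply: big1 => j _; set b := vbasis _.
suff p0 : \poly_(k < d) coord b j (c k) = 0.
  by have := coef_poly d (fun k => coord b j (c k)) i; rewrite ltid p0 coef0 => <-; rewrite scale0r.
set p := \poly_(k < d) _; apply/eqP; apply: contraT => nzp.
(* The integers below [size p] are distinct roots, one more than the degree allows. *)
have := max_poly_roots nzp (rs := [seq k%:R | k <- iota 0 (size p)]).
rewrite size_map size_iota ltnn map_inj_uniq ?iota_uniq; last exact: natr_inj_pchar0.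
apply=> //; apply/allP => t _; rewrite /root horner_poly.
have := congr1 (coord b j) (c0 t); rewrite linear0 linear_sum => /= {2}<-.
by apply/eqP/eq_bigr => k _; rewrite linearZ /= mulrC.
Qed.

End LinearAlgebra.

(** * Bracket calculus, lower central series and generated subalgebras *)

Section LieAlgebra.
Variables (F : fieldType) (L : vectType F) (br : L -> L -> L).
Hypothesis lie_br : lie_bracket br.

Lemma brDl x y z : br (x + y) z = br x z + br y z.
Proof. by case: lie_br => l _ _ _; have := l 1 x y z; rewrite !scale1r. Qed.

Lemma brDr x y z : br z (x + y) = br z x + br z y.
Proof. by case: lie_br => _ l _ _; have := l 1 x y z; rewrite !scale1r. Qed.

Lemma br0x z : br 0 z = 0.
Proof. by apply: (addrI (br 0 z)); rewrite -brDl !addr0. Qed.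

Lemma brx0 z : br z 0 = 0.
Proof. by apply: (addrI (br z 0)); rewrite -brDr !addr0. Qed.

Lemma brZl a x z : br (a *: x) z = a *: br x z.
Proof. by case: lie_br => l _ _ _; have := l a x 0 z; rewrite br0x !addr0. Qed.

Lemma brZr a x z : br z (a *: x) = a *: br z x.
Proof. by case: lie_br => _ l _ _; have := l a x 0 z; rewrite brx0 !addr0. Qed.

Lemma brxx x : br x x = 0. Proof. by case: lie_br. Qed.

Lemma brC x y : br x y = - br y x.
Proof.
apply/eqP; rewrite -addr_eq0; have := brxx (x + y).
by rewrite !brDl !brDr !brxx addr0 add0r => /eqP.
Qed.

Lemma brNr x z : br z (- x) = - br z x.
Proof. by rewrite -scaleN1r brZr scaleN1r. Qed.

Lemma br_derivation x y z : br x (br y z) = br (br x y) z + br y (br x z).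
Proof.
case: lie_br => _ _ _ /(_ x y z)/eqP; rewrite -addrA addr_eq0 => /eqP->.
by rewrite opprD addrC -(brC (br x y)) -brNr -(brC x).
Qed.

Lemma br_brl x y z : br (br x y) z = br x (br y z) - br y (br x z).
Proof. by rewrite (br_derivation x y) addrK. Qed.

Lemma br_suml n (c : 'I_n -> L) z : br (\sum_i c i) z = \sum_i br (c i) z.
Proof. by apply: (big_morph (br^~ z)) => [x y|]; rewrite ?brDl ?br0x. Qed.

Lemma br_sumr n (c : 'I_n -> L) z : br z (\sum_i c i) = \sum_i br z (c i).
Proof. by apply: (big_morph (br z)) => [x y|]; rewrite ?brDr ?brx0. Qed.

Lemma mem_brv (U V : {vspace L}) u v : u \in U -> v \in V -> br u v \in brv br U V.
Proof.
move=> Uu Vv; rewrite (coord_vbasis Uu) (coord_vbasis Vv) br_suml.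
apply: memv_suml => i _; rewrite br_sumr; apply: memv_suml => j _.
rewrite brZl brZr !memvZ // memv_span //.
by apply: allpairs_f; rewrite mem_nth ?size_tuple.
Qed.

Lemma brv_ind (U V : {vspace L}) P : subspace P ->
    (forall u v, u \in U -> v \in V -> P (br u v)) ->
  forall x, x \in brv br U V -> P x.
Proof.
move=> /subspace_vspace[W WP] PUV x.
suff /subvP sW : (brv br U V <= W)%VS by move=> /sW/WP.
apply/span_subvP=> _ /allpairsP[[u v] [/vbasis_mem Uu /vbasis_mem Vv ->]].
exact/WP/PUV.
Qed.

Lemma brv_sub (U V W : {vspace L}) :
  (forall u v, u \in U -> v \in V -> br u v \in W) -> (brv br U V <= W)%VS.
Proof. by move=> UVW; apply/subvP => x; apply: (brv_ind (vspace_subspace W)). Qed.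

Lemma lcsS A n : (lcs br A n.+2 = brv br A (lcs br A n.+1)). Proof. by []. Qed.

Lemma lcs_mono (A B : {vspace L}) n : (A <= B)%VS -> (lcs br A n <= lcs br B n)%VS.
Proof.
move=> sAB; elim: n => [|[|n] IHn] //; rewrite !lcsS.
by apply: brv_sub => u v /(subvP sAB) Bu /(subvP IHn); apply: mem_brv.
Qed.

Lemma nilpotent_sub (A B : {vspace L}) :
  (A <= B)%VS -> nilpotent br B -> nilpotent br A.
Proof.
by move=> sAB [n Bn]; exists n; apply/eqP; rewrite -subv0 -Bn lcs_mono.
Qed.

Lemma nilpotent_ad (A : {vspace L}) h x :
  nilpotent br A -> h \in A -> x \in A -> exists n, iter n (br h) x = 0.
Proof.
(* The shift by one comes from [lcs], whose terms 0 and 1 both equal [A]. *)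
move=> [n An] Ah Ax; exists n.-1; apply/eqP; rewrite -memv0 -An.
suff lcs_iter m : iter m (br h) x \in lcs br A m.+1.
  by case: (n) => // m; apply: lcs_iter.
by elim: m => // m IHm; rewrite lcsS iterS mem_brv.
Qed.

Lemma subspace_generated (S : L -> Prop) :
  subspace (fun x => forall K : {vspace L},
    subalg br K -> (forall z, S z -> z \in K) -> x \in K).
Proof.
split=> [|a x y Kx Ky] K sK SK; first exact: mem0v.
by rewrite memvD ?memvZ ?Kx ?Ky.
Qed.

(** The intersection of all subalgebras containing [S] is a subspace predicate, which
    [subspace_vspace] realizes as a [vspace]. *)
Lemma generated_subalg_exists (S : L -> Prop) : exists A, generated_subalg br S A.
Proof.
have [A AP] := subspace_vspace (subspace_generated S); exists A; split.
- move=> x y /AP Ax /AP Ay; apply/AP => K sK SK.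
  by apply: (sK) => //; [apply: Ax | apply: Ay].
- by move=> x Sx; apply/AP => K _; apply.
by move=> K sK SK; apply/subvP => x /AP; apply.
Qed.

Lemma generated_subalg_mono (S T : L -> Prop) A B :
    generated_subalg br S A -> generated_subalg br T B ->
  (forall z, S z -> T z) -> (A <= B)%VS.
Proof. by move=> [_ _ minA] [sB TB _] ST; apply: minA => // z /ST/TB. Qed.

(** * Upper central series, hypercenter and part (i) *)

Lemma subspace_ucs i : subspace (ucs br i).
Proof.
elim: i => [|i [P0 PL]] /=.
  by split=> // a x y -> ->; rewrite scaler0 addr0.
split=> [y|a x y Px Py z]; first by rewrite br0x.
by rewrite brDl brZl; apply: PL.
Qed.

Lemma ucs_incr i x : ucs br i x -> ucs br i.+1 x.
Proof.
elim: i x => [|i IHi] x /=; first by move=> -> y; rewrite br0x.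
by move=> Px y; apply: IHi.
Qed.

Lemma hypercenterE x : hypercenter br x <-> ucs br (\dim {:L}) x.
Proof.
split=> [[i]|]; last by exists (\dim {:L}).
apply: subspace_chain_stable i x => [i||i st x Px y].
- exact: subspace_ucs.
- exact: ucs_incr.
by apply/st/Px.
Qed.

Lemma hypercenter_vspace :
  exists Z : {vspace L}, forall x, x \in Z <-> hypercenter br x.
Proof.
have [Z ZP] := subspace_vspace (subspace_ucs (\dim {:L})).
by exists Z => x; rewrite ZP hypercenterE.
Qed.

Lemma hypercenter_brl x y : hypercenter br x -> hypercenter br (br x y).
Proof. by move=> [i /ucs_incr Px]; exists i; apply: Px. Qed.

Lemma nilpotent_line_hypercenter (Z : {vspace L}) x :
    (forall z, z \in Z <-> hypercenter br z) ->
  subalg br (<[x]> + Z)%VS /\ nilpotent br (<[x]> + Z)%VS.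
Proof.
move=> ZP; set A := (_ + _)%VS.
(* Since [x, x] = 0, every surviving term of the expanded bracket has an entry in [Z]. *)
have brAA u v : u \in A -> v \in A -> br u v \in Z.
  move=> /memv_addP[_ /vlineP[a ->] [z /ZP Zz ->]].
  move=> /memv_addP[_ /vlineP[b ->] [w /ZP Zw ->]].
  rewrite brDl !brZl brDr brZr brxx scaler0 add0r (brC x) memvD //.
    by rewrite memvZ // memvN; apply/ZP/hypercenter_brl.
  exact/ZP/hypercenter_brl.
split=> [u v Au Av|].
  by rewrite -[br u v]add0r memv_add ?mem0v ?brAA.
(* Term 2 of [lcs] is [A, A], inside Z^* = Z_k for k = dim L; each further term lowers k by one, so
   term dim L + 2 lies in Z_0 = 0. *)
have lcsA i k : (i + k)%N = \dim {:L} ->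
    forall y, y \in lcs br A i.+2 -> ucs br k y.
  elim: i k => [|i IHi] k; rewrite ?addSn => dimL.
    rewrite -[k]add0n dimL => y; rewrite lcsS; apply: brv_ind.
      exact: subspace_ucs.
    by move=> u v Au Av; apply/hypercenterE/ZP/brAA.
  move=> y; rewrite lcsS; apply: brv_ind; first exact: subspace_ucs.
  move=> u v _ /(IHi k.+1) Pv; rewrite brC.
  by apply: (subspaceN (subspace_ucs k)); apply: Pv; rewrite addnS.
exists (\dim {:L}).+2; apply/eqP; rewrite -subv0; apply/subvP => y.
by rewrite memv0 => /(lcsA _ 0%N (addn0 _)) /= ->.
Qed.

(** * Engel's theorem for subquotients of the adjoint module *)

Lemma iter_ad_mem (U : {vspace L}) k n v :
  (forall u, u \in U -> br k u \in U) -> v \in U -> iter n (br k) v \in U.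
Proof. by move=> kU Uv; elim: n => //= n; apply: kU. Qed.

(* The operator [ad (iter c (br m) k)] is [(ad (ad m))^c (ad k)], a combination of
   the [(ad m)^a (ad k) (ad m)^b] with a + b = c. *)
Lemma ad_ad_nilpotent (U V : {vspace L}) m k r :
    (forall u, u \in U -> br m u \in U) -> (forall u, u \in U -> br k u \in U) ->
    (forall v, v \in V -> br m v \in V) -> (forall v, v \in V -> br k v \in V) ->
    (forall v, v \in V -> iter r (br m) v \in U) ->
  forall v, v \in V -> br (iter (r + r) (br m) k) v \in U.
Proof.
move=> mU kU mV kV nilm.
(* Once [c] is 0, [a] or [b] is at least [r], and that power of [br m] maps [V] into [U]. *)
suff gen c a b v : (r + r <= a + b + c)%N -> v \in V ->
    iter a (br m) (br (iter c (br m) k) (iter b (br m) v)) \in U.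
  by move=> v Vv; apply: (gen (r + r)%N 0%N 0%N).
elim: c a b => [|c IHc] a b le_r Vv /=.
  have [le_rb|lt_br] := leqP r b.
    apply: iter_ad_mem => //; apply: kU.
    by rewrite -(subnKC le_rb) addnC iterD iter_ad_mem ?nilm.
  have le_ra : (r <= a)%N.
    rewrite leqNgt; apply/negP => lt_ar; move: le_r; rewrite addn0 leqNgt.
    by rewrite (ltn_trans _ (_ : (a + r < _)%N)) ?ltn_add2l ?ltn_add2r.
  rewrite -(subnKC le_ra) addnC iterD iter_ad_mem // nilm // kV //.
  exact: iter_ad_mem.
(* Expanding the outermost [br m] moves one unit from [c] to [a] or to [b]. *)
rewrite br_brl.
have iterB n x y : iter n (br m) (x - y) = iter n (br m) x - iter n (br m) y.
  by elim: n => //= n ->; rewrite brDr brNr.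
rewrite iterB -iterSr -iterS memvB // IHc //.
  by rewrite addSn addSnnS.
by rewrite addnS addSnnS.
Qed.

Lemma first_step (P : nat -> Prop) n :
  ~ P 0%N -> P n -> exists2 j, ~ P j & P j.+1.
Proof.
move=> nP0; elim: n => // n IHn Pn1.
by have [/IHn|nPn] := classic (P n); last by exists n.
Qed.

(* All modules needed are subquotients of the adjoint one, including K / M in the
   induction step, so quotients are encoded by pairs of subspaces of L. C is the
   kernel of the action of K on V modulo U: since only ad K on V is assumed
   nilpotent, M must contain C for M to act nilpotently on K / M. *)
Lemma engel (K U V : {vspace L}) :
    subalg br K ->
    (forall k u, k \in K -> u \in U -> br k u \in U) ->
    (forall k v, k \in K -> v \in V -> br k v \in V) ->
    (forall k, k \in K ->
       exists n, forall v, v \in V -> iter n (br k) v \in U) ->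
    ~~ (V <= U)%VS ->
  exists v, [/\ v \in V, v \notin U & forall k, k \in K -> br k v \in U].
Proof.
have [n] := ubnP (\dim K); elim: n K U V => // n IHn K U V ltKn sK KU KV nilK VU.
have sC : subspace (fun k => k \in K /\ forall v, v \in V -> br k v \in U).
  split=> [|a x y [Kx xV] [Ky yV]].
    by split=> [|v _]; rewrite ?br0x mem0v.
  split=> [|v Vv]; first by rewrite memvD ?memvZ.
  by rewrite brDl brZl memvD ?memvZ ?xV ?yV.
have [C CP] := subspace_vspace sC.
have CK : (C <= K)%VS by apply/subvP => x /CP[].
(* Enlarge [M] from [C] up to [K], always keeping a vector of [V] outside [U] that [M] sends into
   [U]; [d] bounds the codimension of [M] in [K]. *)
suff grow d (M : {vspace L}) : (\dim K - \dim M < d)%N ->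
    (C <= M)%VS -> (M <= K)%VS -> subalg br M ->
    (exists v, [/\ v \in V, v \notin U & forall k, k \in M -> br k v \in U]) ->
    exists v, [/\ v \in V, v \notin U & forall k, k \in K -> br k v \in U].
  apply: (grow _ C (ltnSn _)) => //.
    move=> x y /CP[Kx xV] /CP[Ky yV]; apply/CP; split=> [|v Vv]; first exact: sK.
    by rewrite br_brl; apply: memvB; apply: KU => //; [apply: yV | apply: xV].
  have [v Vv Uv] := subvPn VU.
  by exists v; split=> // k /CP[_]; apply.
elim: d M => // d IHd M ltd CM MK sM [v0 [Vv0 Uv0 Mv0]].
have [KM|nKM] := boolP (K <= M)%VS.
  by exists v0; split=> // k /(subvP KM); apply: Mv0.
have ltMK : (\dim M < \dim K)%N.
  by rewrite ltn_neqAle (dimv_leqif_sup MK) nKM dimvS.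
(* Induction applied to [M] acting on K / M gives [k] in [K] outside [M] with [M, k] inside [M]. *)
have [m k /(subvP MK) Km|m /(subvP MK) Km||k [Kk Mk kM]] :=
  IHn M M K (leq_trans ltMK ltKn) sM sM.
- exact: sK.
- have [r nilm] := nilK m Km; exists (r + r)%N => k Kk.
  apply/(subvP CM)/CP; split.
    by apply: iter_ad_mem => // u; apply: sK.
  by apply: ad_ad_nilpotent => // u; [apply: KU|apply: KU|apply: KV|apply: KV].
- by [].
have [r nilk] := nilK k Kk.
(* The last iterate of [v0] under [br k] outside [U] is sent into [U] by [k]; it is the new common
   vector. *)
have [j] := @first_step (fun j => iter j (br k) v0 \in U) r
  (elimN idP Uv0) (nilk v0 Vv0).
move=> /negP Uj kj.
have Vj i : iter i (br k) v0 \in V.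
  by apply: iter_ad_mem => // v; apply: KV.
(* As [k] normalizes [M], applying [br k] preserves the property of being sent into [U] by [M]. *)
have Mj i m : m \in M -> br m (iter i (br k) v0) \in U.
  elim: i m => [|i IHi] m Mm /=; first exact: Mv0.
  by rewrite br_derivation memvD ?(KU k) ?IHi // kM.
apply: (IHd (M + <[k]>)%VS).
- have := dim_add_line Mk => lt; rewrite -ltnS (leq_trans _ ltd) // ltnS.
  exact: ltn_sub2l.
- exact: subv_trans CM (addvSl _ _).
- by rewrite subv_add MK -memvE.
- move=> u w /memv_addP[x Mx [_ /vlineP[a ->] ->]].
  move=> /memv_addP[y My [_ /vlineP[b ->] ->]].
  rewrite brDl !brDr !brZl !brZr brxx !scaler0 addr0 (brC k y).
  apply: (subvP (addvSl _ _)).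
  by rewrite !memvD ?memvZ ?memvN ?kM ?sM.
exists (iter j (br k) v0); split=> // _ /memv_addP[m Mm [_ /vlineP[a ->] ->]].
by rewrite brDl brZl; apply: memvD; [apply: Mj | apply/memvZ/kj].
Qed.

(** * Right Engel elements and part (ii) *)

(* [ad_coef h k x n i] is the coefficient of [t ^ i] in [(ad (h + t k))^n x]. *)
Fixpoint ad_coef (h k x : L) (n i : nat) : L :=
  match n, i with
  | 0, 0 => x
  | 0, _.+1 => 0
  | m.+1, 0 => br h (ad_coef h k x m 0)
  | m.+1, j.+1 => br h (ad_coef h k x m j.+1) + br k (ad_coef h k x m j)
  end.

Lemma ad_coef_gt h k x n i : (n < i)%N -> ad_coef h k x n i = 0.
Proof.
elim: n i => [|n IHn] [|i] //= lt_ni.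
by rewrite !IHn ?brx0 ?addr0 // ltnW.
Qed.

Lemma iter_ad_expansion h k x n (t : F) :
  iter n (br (h + t *: k)) x = \sum_(i < n.+1) t ^+ i *: ad_coef h k x n i.
Proof.
elim: n => [|n IHn]; first by rewrite big_ord1 scale1r.
rewrite iterS IHn brDl brZl !br_sumr [RHS]big_ord_recl /=.
under [in RHS]eq_bigr do rewrite scalerDr.
rewrite big_split /= addrA; congr (_ + _).
  rewrite [LHS]big_ord_recl [in RHS]big_ord_recr /= (@ad_coef_gt _ _ _ n n.+1) // brx0 scaler0 addr0.
  by rewrite brZr; congr (_ + _); apply: eq_bigr => i _; rewrite brZr.
by rewrite scaler_sumr; apply: eq_bigr => i _; rewrite brZr scalerA -exprS.
Qed.

Lemma ad_coef0 h k x n : ad_coef h k x n 0 = iter n (br h) x.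
Proof. by elim: n => //= n ->. Qed.

(* For [k] replaced by [[h, k]], the linear coefficient telescopes. *)
Lemma ad_coef1 h k x n :
  ad_coef h (br h k) x n 1 = iter n (br h) (br k x) - br k (iter n (br h) x).
Proof.
elim: n => [|n IHn] /=; first by rewrite subrr.
by rewrite IHn ad_coef0 brDr brNr br_brl addrA addrNK.
Qed.

(** The exponent does not depend on [h], so that along a line of elements [h] a single polynomial of
    fixed degree vanishes. *)
Definition right_engel (x : L) : Prop :=
  forall h, iter (\dim {:L}) (br h) x = 0.

Lemma subspace_iter_ad n h : subspace (fun x => iter n (br h) x = 0).
Proof.
split=> [|a x y]; first by elim: n => //= n ->; rewrite brx0.
have -> : iter n (br h) (a *: x + y) = a *: iter n (br h) x + iter n (br h) y.
  by elim: n => //= n ->; rewrite brDr brZr.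
by move=> -> ->; rewrite scaler0 addr0.
Qed.

Lemma subspace_right_engel : subspace right_engel.
Proof.
split=> [h|a x y Ex Ey h]; have [E0 EL] := subspace_iter_ad (\dim {:L}) h => //.
exact: EL.
Qed.

(** The kernels of the powers of [br h] form an ascending chain that stays constant after its first
    repetition. *)
Lemma right_engelP x : (forall h, exists n, iter n (br h) x = 0) -> right_engel x.
Proof.
move=> nilx h; have [n] := nilx h.
apply: (@subspace_chain_stable _ _ (fun n x => iter n (br h) x = 0)).
- by move=> i; apply: subspace_iter_ad.
- by move=> i y /= ->; rewrite brx0.
by move=> i st y; rewrite iterSr => /st; rewrite -iterSr.
Qed.

Lemma right_engel_ideal k x :
  [pchar F] =i pred0 -> right_engel x -> right_engel (br k x).
Proof.
move=> ch0 Ex h.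
(* A linear coefficient exists among the dim L + 1 coefficients only if dim L is positive. *)
have [dim0|dim_gt0] := posnP (\dim {:L}).
  move/eqP: (dim0); rewrite dimv_eq0 dim0 => /eqP L0 /=.
  by have := memvf (br k x); rewrite L0 memv0 => /eqP.
have /vector_poly_eq0 : forall t : F,
    \sum_(i < (\dim {:L}).+1) t ^+ i *: ad_coef h (br h k) x (\dim {:L}) i = 0.
  by move=> t; rewrite -iter_ad_expansion Ex.
move=> /(_ ch0 1%N); rewrite ltnS => /(_ dim_gt0).
by rewrite ad_coef1 Ex brx0 subr0.
Qed.

Lemma right_engel_hypercenter x :
  [pchar F] =i pred0 -> right_engel x -> hypercenter br x.
Proof.
move=> ch0 Ex; have [Z ZP] := hypercenter_vspace.
have [V VP] := subspace_vspace subspace_right_engel.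
apply: NNPP => nZx.
have [|k u _ /ZP Zu|k v _ /VP Ev|k _||v [Vv /negP Zv brv]] := @engel fullv Z V.
- by move=> *; apply: memvf.
- by rewrite brC memvN; apply/ZP/hypercenter_brl.
- exact/VP/right_engel_ideal.
- by exists (\dim {:L}) => v /VP ->; apply: mem0v.
- by apply/subvPn; exists x; [apply/VP | apply/negP => /ZP].
(* All brackets of [v] lie in Z^*, the term of index dim L, so [v] lies in the next term. *)
apply/Zv/ZP; exists (\dim {:L}).+1 => y.
by apply/hypercenterE/ZP; rewrite brC memvN brv ?memvf.
Qed.

End LieAlgebra.

Theorem theorem3p4 (F : fieldType) (L : vectType F) (br : L -> L -> L) :
  lie_bracket br ->
  (forall x : L, exists A : {vspace L},
      generated_subalg br (fun z => z = x \/ hypercenter br z) A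
      /\ nilpotent br A)
  /\ ([pchar F] =i pred0 ->
      forall x : L, hypercenter br x <-> nilset br x).
Proof.
move=> lie_br.
have part1 x : exists A : {vspace L},
    generated_subalg br (fun z => z = x \/ hypercenter br z) A /\ nilpotent br A.
  have [Z ZP] := hypercenter_vspace lie_br.
  have [A genA] := generated_subalg_exists br (fun z => z = x \/ hypercenter br z).
  have [sB nilB] := nilpotent_line_hypercenter lie_br x ZP.
  exists A; split=> //; apply: nilpotent_sub nilB => //.
  case: genA => _ _; apply=> // z [->|/ZP Zz].
    exact: (subvP (addvSl _ _)) (memv_line x).
  exact: (subvP (addvSr _ _)) Zz.
split=> // ch0 x; split=> [Zx h|nilx].
  have [A genA] := generated_subalg_exists br (fun z => z = h \/ z = x).
  (* As [x] is in Z^*, the subalgebra generated by [h] and [x] sits inside the one generated by [h]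
     and Z^*. *)
  have [B [genB nilB]] := part1 h; exists A; split=> //.
  apply: nilpotent_sub nilB => //; apply: generated_subalg_mono genA genB _.
  by move=> z [->|->]; [left | right].
apply: right_engel_hypercenter => //; apply: right_engelP => // h.
have [A [[_ SA _] nilA]] := nilx h.
by apply: nilpotent_ad nilA _ _ => //; apply: SA; [left | right].
Qed.
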